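(* Let $G$ be a finite simple graph. If $G$ is homomorphic to the Andrásfai graph $F_d$ for some integer $d\ge 1$ (i.e. there is a graph homomorphism $G\to F_d$), then $G$ is not $\left(\frac12,\frac1{50}\right)$-dense.
   Context: All graphs are finite and simple. An $n$-vertex graph $G$ is called $(\alpha,\beta)$-dense if every subset of $\lfloor \alpha n\rfloor$ vertices of $G$ spans (induces) more than $\beta n^2$ edges. For an integer $d\ge 1$ the Andrásfai graph $F_d$ is the $d$-regular graph with vertex set $V(F_d)=\{v_1,\dots,v_{3d-1}\}$ in which $\{v_i,v_j\}$ is an edge if and only if $d\le |i-j|\le 2d-1$. *)

(* Defs.v *)
From mathcomp Require Import all_boot all_order all_algebra.

Set Implicit Arguments.
Unset Strict Implicit.
Unset Printing Implicit Defensive.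

Import Order.TTheory GRing.Theory Num.Theory.

Record sgraph := SGraph {
  vertex :> finType;
  adj : rel vertex;
  adj_sym : symmetric adj;
  adj_irr : irreflexive adj
}.

Definition edges (G : sgraph) : {set {set G}} :=
  [set [set p.1; p.2] | p : G * G & adj p.1 p.2].

(* The edges of the subgraph of G induced by A. *)
Definition induced_edges (G : sgraph) (A : {set G}) : {set {set G}} :=
  [set E in edges G | E \subset A].

Definition dense (R : archiRealFieldType) (alpha beta : R) (G : sgraph) : Prop :=
  forall A : {set G},
    (#|A|%:Z = Num.floor (alpha * #|G|%:R))%R ->
    (beta * #|G|%:R ^+ 2 < #|induced_edges A|%:R)%R.

Definition is_hom (G H : sgraph) (f : G -> H) : Prop :=
  forall x y : G, adj x y -> adj (f x) (f y).

Definition homomorphic (G H : sgraph) : Prop := exists f : G -> H, is_hom f.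

(* Vertices are numbered from 0 instead of 1, which does not affect |i - j|. *)
Definition andrasfai_rel (d : nat) : rel 'I_(3 * d - 1) :=
  fun i j => d <= `|i - j|%N <= 2 * d - 1.

Lemma andrasfai_sym d : symmetric (@andrasfai_rel d).
Proof. by move=> i j; rewrite /andrasfai_rel distnC. Qed.

Lemma andrasfai_irr d : irreflexive (@andrasfai_rel d).
Proof.
case: d => [|d] i; first by case: i.
by rewrite /andrasfai_rel distnn.
Qed.

Definition andrasfai (d : nat) : sgraph :=
  SGraph (@andrasfai_sym d) (@andrasfai_irr d).

(* Main.v *)
(* Replace G by the blow-up H of F_d on the same vertex set, let Q be its degree
   sum and h = floor(n/2).  Suppose that every h-set spans more than n^2/50 edges
   of H; then Q < 2n^2/5 and Q > 2n^2/5.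

   The upper bound holds in every triangle-free graph (Keevash and Sudakov).
   For an edge uv the neighbourhoods A, B of u, v are disjoint and independent;
   completing each of them to an h-set by suitable vertices of the rest C forces
   the degree sum of C above 2n^2/25.  That sum is Q minus the degree sums of A
   and B, so averaging over the edges uv and using that there are at least
   Q^3/n^2 walks of length 3 gives (5Q - 2n^2)(10Q - n^2) < 0.

   For the lower bound, list the vertices in the cyclic order of F_d.  Let m be
   the number of vertices in the window [t, t+h) that have a neighbour further
   right in the window.  Counting pairs (s, u) with s in [t, t+m) and u following
   s at distance at most n/2, twice below n/2 and once at n/2, gives at least
   2e(window) + m^2 > n^2/25 + m^2 >= (2n/5) m.  A summation over the circle of
   these tiles of length m gives Q > (2n/5) n. *)
Require Import Defs.
From mathcomp Require Import all_boot all_order all_algebra.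
From mathcomp Require Import zify ring lra.

Set Implicit Arguments.
Unset Strict Implicit.
Unset Printing Implicit Defensive.

Import Order.TTheory GRing.Theory Num.Theory.

(** * Averaging tools *)

(** Deleting an element of largest weight never raises the average weight; this is repeated until
    [r] elements remain. *)
Lemma light_subset (T : finType) (x : T -> nat) (C : {set T}) r : r <= #|C| ->
  exists S : {set T}, [/\ S \subset C, #|S| = r &
    #|C| * \sum_(w in S) x w <= r * \sum_(w in C) x w].
Proof.
elim/ltn_ind: {C}#|C| {-2}C (erefl #|C|) => c IH C cC; rewrite leq_eqVlt.
case/orP=> [/eqP-> | rC]; first by exists C; rewrite cC; split.
have [->|r0] := posnP r.
  by exists set0; rewrite sub0set cards0 big_set0 muln0; split.
have /card_gt0P[w0 w0C] : 0 < #|C| by lia.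
case: (@arg_maxnP _ w0 (mem C) x w0C) => w wC wmax.
have {}wC : w \in C by [].
have cC' : #|C :\ w| = c - 1 by move: (cardsD1 w C); rewrite wC cC; lia.
have [||S [SC Sr IHle]] := IH (c - 1) _ (C :\ w) cC'; rewrite ?cC'; try lia.
exists S; split=> //; first exact: subset_trans SC (subsetDl _ _).
have: \sum_(i in C :\ w) x i <= (c - 1) * x w.
  rewrite -cC' -sum_nat_const; apply: leq_sum => i; rewrite !inE => /andP[_ iC].
  exact: wmax.
rewrite (big_setD1 w wC) /=.
set X := \sum_(i in S) _; set Y := \sum_(i in _ :\ _) _ in IHle * => Yle.
have c1 : 0 < c - 1 by lia.
by rewrite -(leq_pmul2l c1); nia.
Qed.

(** AM-GM for [q / x], [q / y] and the inverse of their product. *)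
Lemma am_gm3 (R : realFieldType) (q x y : R) : (0 < q -> 0 < x -> 0 < y ->
  3 <= x * y / q ^+ 2 + q / x + q / y)%R.
Proof.
move=> q0 x0 y0.
have a0 : (0 < q / x)%R by rewrite divr_gt0.
have b0 : (0 < q / y)%R by rewrite divr_gt0.
have -> : (x * y / q ^+ 2 = (q / x * (q / y))^-1)%R.
  by field; rewrite !gt_eqF.
move: (q / x)%R (q / y)%R a0 b0 => a b a0 b0.
have ab0 : (0 < a * b)%R by rewrite mulr_gt0.
have: (3 * (a * b) <= 1 + (a * b) * (a + b))%R.
  have [s3|s3] := leP 3%R (a + b)%R; first by nra.
  (* For s = a + b < 3, the bound 4ab <= s^2 leaves 4 - s^2 (3 - s) = (s - 2)^2 (s + 1) >= 0 to be
     used. *)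
  have : (0 <= (a + b - 2) ^+ 2 * (a + b + 1))%R.
    by rewrite mulr_ge0 ?sqr_ge0 // !addr_ge0 // ltW.
  have : (0 <= (a - b) ^+ 2 * (3 - (a + b)))%R.
    by rewrite mulr_ge0 ?sqr_ge0 // subr_ge0 ltW.
  by lra.
move=> le3; rewrite -(ler_pM2r ab0).
have scaled : (((a * b)^-1 + a + b) * (a * b) = 1 + a * b * (a + b))%R.
  by field; rewrite !gt_eqF.
by rewrite scaled.
Qed.

(** * Upper bound on the degree sum of a triangle-free graph *)

Section SparseHalfDenseGraph.

Variables (T : finType) (e : rel T).
Hypothesis e_sym : symmetric e.

Let n := #|T|.
Let h := n./2.
Let deg x := \sum_y e x y.
Let deg2 x := \sum_y e x y * deg y.
Let Q := \sum_x deg x.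

Lemma deg_card x : deg x = #|[set y | e x y]|.
Proof.
rewrite /deg -sum1_card [RHS]big_mkcond; apply: eq_bigr => y _.
by rewrite inE; case: (e x y).
Qed.

(* [deg x * deg2 x] counts the walks of length 3 with second vertex [x]; the
   bound is am_gm3 with [q] the average degree, summed over all edges [xy]. *)
Lemma walks3 : Q ^ 3 <= n ^ 2 * \sum_x deg x * deg2 x.
Proof.
have [->//|Q0] := posnP Q.
have n0 : 0 < n.
  by rewrite lt0n; apply: contraTneq Q0 => /card0_eq T0; rewrite /Q big_pred0.
pose q : rat := (Q%:R / n%:R)%R.
have q0 : (0 < q)%R by rewrite divr_gt0 ?ltr0n.
have edge x y : (3 * (e x y)%:R <=
    (e x y)%:R * (deg x * deg y)%:R / q ^+ 2
    + (q * ((e x y)%:R / (deg x)%:R) + q * ((e x y)%:R / (deg y)%:R)) :> rat)%R.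
  case exy: (e x y); last by rewrite !mul0r !mulr0 !addr0.
  have dx : 0 < deg x by rewrite deg_card; apply/card_gt0P; exists y; rewrite inE.
  have dy : 0 < deg y by rewrite deg_card; apply/card_gt0P; exists x; rewrite inE e_sym.
  rewrite natrM !mul1r mulr1 addrA.
  by apply: am_gm3; rewrite ?ltr0n.
have inv_le : (\sum_x \sum_y (e x y)%:R / (deg x)%:R <= n%:R :> rat)%R.
  rewrite /n -sum1_card natr_sum; apply: ler_sum => x _.
  rewrite -mulr_suml -natr_sum -/(deg x).
  by have [->|d0] := posnP (deg x); rewrite ?mul0r // divff // pnatr_eq0 -lt0n.
have : (3 * Q%:R <= (\sum_x deg x * deg2 x)%:R / q ^+ 2 + (q * n%:R + q * n%:R) :> rat)%R.
  apply: (@le_trans _ _ (\sum_x \sum_y 3 * (e x y)%:R)%R).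
    rewrite /Q natr_sum mulr_sumr; apply: ler_sum => x _.
    by rewrite /deg natr_sum mulr_sumr.
  apply: le_trans.
    by apply: ler_sum => x _; apply: ler_sum => y _; apply: edge.
  rewrite /=; under eq_bigr do rewrite !big_split /=.
  rewrite !big_split /=; apply: lerD; last apply: lerD.
  - rewrite natr_sum mulr_suml; apply: ler_sum => x _.
    rewrite -mulr_suml ler_pM2r ?invr_gt0 ?exprn_gt0 // /deg2 big_distrr /= natr_sum.
    by apply: ler_sum => y _; rewrite -natrM mulnCA.
  - under eq_bigr do rewrite -mulr_sumr.
    by rewrite -mulr_sumr ler_pM2l.
  - rewrite exchange_big /=; under eq_bigr do rewrite -mulr_sumr.
    rewrite -mulr_sumr ler_pM2l //; apply: le_trans inv_le.
    by apply: ler_sum => x _; apply: ler_sum => y _; rewrite e_sym.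
(* The last two terms thus add up to 2Q, which leaves Q q^2 as a lower bound for the walk count. *)
have -> : (q * n%:R = Q%:R :> rat)%R by rewrite /q divfK // pnatr_eq0 -lt0n.
set W := \sum_x _ => le3.
have {le3} : (Q%:R * q ^+ 2 <= W%:R)%R.
  by rewrite -ler_pdivlMr ?exprn_gt0 //; lra.
rewrite /q expr_div_n mulrA ler_pdivrMr ?exprn_gt0 ?ltr0n //.
by rewrite -exprS -!natrX -natrM ler_nat mulnC.
Qed.

Hypothesis triangle_free : forall x y z, e x y -> e y z -> ~~ e x z.
(** The double sum counts every edge twice, hence 25 in place of 50. *)
Hypothesis half_dense : forall A : {set T}, #|A| = h ->
  n ^ 2 < 25 * \sum_(x in A) \sum_(y in A) e x y.

Definition independent (A : {set T}) := {in A &, forall x y, ~~ e x y}.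

Lemma sum_indep (A : {set T}) : independent A -> \sum_(x in A) \sum_(y in A) e x y = 0.
Proof.
move=> iA; rewrite big1 // => x xA; rewrite big1 // => y yA.
by rewrite (negPf (iA x y xA yA)).
Qed.

Lemma indep_lt (A : {set T}) : independent A -> #|A| < h.
Proof.
move=> iA; rewrite ltnNge; apply/negP => /(light_subset (fun=> 0))[S [SA Sh _]].
have := half_dense Sh; rewrite sum_indep ?muln0 // => x y xS yS.
by apply: iA; apply: (subsetP SA).
Qed.

(** Complete [A] to an h-set by a light subset S of [C]. The weight of w counts its neighbours in
    all of [C], not only in S: this bounds the edge count from above and does not depend on S, so
    [light_subset] applies. *)
Lemma extend_indep (A C : {set T}) : independent A -> [disjoint A & C] ->
    h <= #|A| + #|C| ->
  n ^ 2 * #|C| < 25 * ((h - #|A|) *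
     \sum_(w in C) (2 * \sum_(y in A) e w y + \sum_(y in C) e w y)).
Proof.
move=> iA dAC hAC; have Ah := indep_lt iA.
pose x w := 2 * \sum_(y in A) e w y + \sum_(y in C) e w y.
rewrite -[X in _ * (_ * X)]/(\sum_(w in C) x w).
have [S [SC Sr Sx]] : exists S : {set T}, [/\ S \subset C, #|S| = h - #|A| &
    #|C| * \sum_(w in S) x w <= (h - #|A|) * \sum_(w in C) x w].
  by apply: light_subset; lia.
have dAS : [disjoint A & S] by apply: disjointWr dAC.
have c0 : 0 < #|C| by lia.
have: n ^ 2 < 25 * \sum_(w in S) x w.
  have cAS : #|A :|: S| = h by rewrite cardsU disjoint_setI0 // cards0 Sr; lia.
  apply: leq_trans (half_dense cAS) _; rewrite leq_pmul2l //.
  have split (F : T -> nat) : \sum_(z in A :|: S) F z = \sum_(z in A) F z + \sum_(z in S) F z.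
    by rewrite (eq_bigl [predU A & S]) ?bigU // => z; rewrite !inE.
  rewrite [leqRHS]big_split -big_distrr /=.
  rewrite split; under eq_bigr do rewrite split.
  under [X in _ + X]eq_bigr do rewrite split.
  rewrite [\sum_(z in A) _]big_split [\sum_(z in S) (_ + _)]big_split /=.
  rewrite sum_indep // add0n exchange_big /=.
  under eq_bigr do under eq_bigr do rewrite e_sym.
  rewrite addnA addnn -mul2n leq_add2l; apply: leq_sum => w _.
  by rewrite [leqRHS](big_setID S) /= (setIidPr SC) leq_addr.
by move: Sx; set X := \sum_(w in S) _; set Y := \sum_(w in C) _; nia.
Qed.

Lemma edge_bound u v : e u v -> 2 * n ^ 2 + 25 * (deg2 u + deg2 v) < 25 * Q.
Proof.
move=> euv; pose N x := [set y | e x y].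
have iN x : independent (N x).
  by move=> y z; rewrite !inE e_sym => exy; apply: triangle_free exy.
have dN : [disjoint N u & N v].
  rewrite -setI_eq0; apply/eqP/setP => z; rewrite !inE; apply/negP => /andP[euz].
  by apply/negP; rewrite e_sym in euv; have := triangle_free euv euz.
pose C := ~: (N u :|: N v).
have cC : #|N u| + #|N v| + #|C| = n.
  by rewrite /n -(cardsC (N u :|: N v)) cardsU disjoint_setI0 // cards0 subn0.
have dC x : x \in [set u; v] -> [disjoint N x & C].
  move=> xuv; rewrite -setI_eq0; apply/eqP/setP => z; rewrite !inE.
  by move: xuv; rewrite !inE => /orP[]/eqP->; case: (e u z); case: (e v z).
have hu := indep_lt (iN u); have hv := indep_lt (iN v).
have hn : h + h <= n by rewrite /h; lia.
have := extend_indep (iN u) (dC u _); have := extend_indep (iN v) (dC v _).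
rewrite !inE !eqxx ?orbT; move=> /(_ isT) eB /(_ isT) eA.
have {}eA := eA ltac:(lia); have {}eB := eB ltac:(lia).
have split (F : T -> nat) :
    \sum_z F z = \sum_(z in N u) F z + \sum_(z in N v) F z + \sum_(z in C) F z.
  rewrite (bigID (mem (N u :|: N v))) /=; congr addn.
    by rewrite (eq_bigl [predU N u & N v]) ?bigU // => z; rewrite !inE.
  by apply: eq_bigl => z; rewrite !inE.
have degN x : deg2 x = \sum_(z in N x) deg z.
  rewrite /deg2 [RHS]big_mkcond; apply: eq_bigr => y _; rewrite inE.
  by case: (e x y); rewrite ?mul1n.
have := split deg; rewrite -/Q -!degN => ->.
set Z := \sum_(z in C) deg z.
suff: 2 * n ^ 2 < 25 * Z by lia.
move: eA eB; set X := \sum_(w in C) _; set Y := \sum_(w in C) _ => eA eB.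
(* The weights of w in the two completions add up to [2 * deg w]. *)
have XYZ : X + Y = 2 * Z.
  rewrite /X /Y /Z -big_split big_distrr; apply: eq_bigr => w _ /=.
  by rewrite [deg w]split; lia.
move: eA eB; set a := h - #|N u|; set c := h - #|N v| => eA eB.
have ac : a + c <= #|C| by lia.
have a0 : 0 < a by lia.
have c0 : 0 < c by lia.
(* Add c times [eA] to a times [eB] and use 4ac <= (a + c)^2 <= (a + c)|C|. *)
suff: 4 * n ^ 2 * (a * c) < 25 * (X + Y) * (a * c) by rewrite ltn_pmul2r ?muln_gt0 ?a0 //; lia.
have : 4 * (a * c) <= (a + c) * (a + c).
  by have := (nat_AGM2 a c).1; rewrite -mulnn.
move: eA eB; move: (n ^ 2) => N2 eA eB ac4.
apply: (@leq_ltn_trans (N2 * ((a + c) * #|C|))).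
  by rewrite -mulnA mulnCA leq_mul2l (leq_trans ac4) ?orbT // leq_mul2l ac orbT.
by move: eA; rewrite -(ltn_pmul2r c0); move: eB; rewrite -(ltn_pmul2r a0); lia.
Qed.

Lemma dense_edges_lt : 0 < n -> 5 * Q < 2 * n ^ 2.
Proof.
move=> n0; have [->|Q0] := posnP Q; first by rewrite muln0 muln_gt0 expn_gt0 n0.
have: \sum_x \sum_y e x y * (2 * n ^ 2 + 25 * (deg2 x + deg2 y) + 1)
    <= \sum_x \sum_y e x y * (25 * Q).
  apply: leq_sum => x _; apply: leq_sum => y _.
  by have := @edge_bound x y; case: (e x y) => // /(_ isT); rewrite !mul1n addn1.
have sumc k : \sum_x \sum_y e x y * k = Q * k.
  by rewrite big_distrl; apply: eq_bigr => x _; rewrite big_distrl.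
have -> : \sum_x \sum_y e x y * (2 * n ^ 2 + 25 * (deg2 x + deg2 y) + 1) =
    Q * (2 * n ^ 2 + 1) + 50 * \sum_x deg x * deg2 x.
  have half : \sum_x \sum_y e x y * (25 * deg2 x) = 25 * \sum_x deg x * deg2 x.
    by rewrite big_distrr; apply: eq_bigr => x _; rewrite -big_distrl /= mulnCA.
  rewrite -sumc (_ : 50 = 25 + 25) // mulnDl -{1}half -half addnA.
  rewrite [X in _ = _ + X]exchange_big /= -!big_split; apply: eq_bigr => x _.
  rewrite -!big_split /=; apply: eq_bigr => y _; rewrite [e y x]e_sym -!mulnDr.
  by congr muln; lia.
rewrite sumc; have := walks3; move: (\sum_x deg x * deg2 x) => W.
rewrite !expnS expn0 !muln1 => W3 eQ.
have nn0 : 0 < n * n by rewrite muln_gt0 n0.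
have QN0 : 0 < Q * (n * n) by rewrite muln_gt0 Q0.
have {W3 eQ} : Q * (2 * (n * n) * (n * n) + 50 * (Q * Q)) < Q * (25 * Q * (n * n)).
  by move: nn0 QN0 W3 (leq_mul (leqnn (n * n)) eQ); move: (n * n) => N2; lia.
rewrite ltn_pmul2l //; move: (n * n) => N2 quad; rewrite ltnNge.
(* With N = n^2, [quad] says (5Q - 2N)(10Q - N) < 0. If 5Q = 2N + k with k >= 0, the factors are k
   and 3N + 2k. *)
apply/negP => le5; have QE := subnKC le5.
move: QE (congr1 (fun z => z * z) QE) (congr1 (muln N2) QE) quad => /=.
by move: (5 * Q - 2 * N2) => k; lia.
Qed.

End SparseHalfDenseGraph.

(** * Lower bound on the degree sum from the cyclic order *)

Lemma big_nat_addn (F : nat -> nat) t m :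
  \sum_(0 <= s < t + m) F s = \sum_(0 <= s < t) F s + \sum_(0 <= s < m) F (s + t).
Proof.
rewrite (@big_cat_nat _ _ _ t) //= ?leq_addr //; congr addn.
by rewrite -{1}[t]add0n big_addn addKn.
Qed.

Section CircularOrder.

(** [P s] is the position of the s-th vertex on the circle unrolled to a line; one turn passes n
    vertices and has length 3d - 1. *)
Variables (n d : nat) (P : nat -> nat).
Hypotheses (n_gt0 : 0 < n) (d_gt0 : 0 < d).
Hypothesis P_mono : {homo P : s u / s <= u}.
Hypothesis P_period : forall s, P (s + n) = P s + (3 * d - 1).

Let h := n./2.
Let b s k := d <= P (s + k) - P s <= 2 * d - 1.

Lemma half_le : h + h <= n.
Proof. by rewrite /h; lia. Qed.

Lemma arc_period s k : b (s + n) k = b s k.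
Proof. by rewrite /b addnAC !P_period subnDr. Qed.

(** The two arcs between two vertices have total length 3d - 1, and x -> 3d - 1 - x preserves the
    interval [d, 2d - 1]. *)
Lemma arc_opp s k : k <= n -> b s k = b (s + k) (n - k).
Proof.
move=> kn; rewrite /b -addnA subnKC // P_period.
have := P_mono (leq_addr k s); have: P (s + k) <= P (s + n) by apply: P_mono; lia.
by rewrite P_period; lia.
Qed.

Lemma sum_period_shift (F : nat -> nat) k :
  (forall s, F (s + n) = F s) ->
  \sum_(0 <= s < n) F (s + k) = \sum_(0 <= s < n) F s.
Proof.
move=> FP; elim: k => [|k IH]; first by under eq_bigr do rewrite addn0.
rewrite -{}IH; under eq_bigr do rewrite addnS -addSn.
by rewrite -(big_add1 _ _ 0 n.+1 xpredT (fun s => F (s + k))) /=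
  [RHS]big_ltn // big_nat_recr //= addnC; congr addn; rewrite add0n addnC FP.
Qed.

Definition window_edges t :=
  \sum_(0 <= i < h) \sum_(1 <= k < h - i) b (t + i) k.

(* Counts the arcs from [s] shorter than [n / 2] twice and an arc of length
   [n / 2] once: every edge is the short arc of exactly one of its ends, except
   that both arcs have length [n / 2] for antipodal ends. *)
Definition half_deg s := \sum_(1 <= k < h.+1) b s k + \sum_(1 <= k < n - h) b s k.

(** Complementary arcs exchange the numbers of steps 1..h and n - h..n - 1; moving the base point
    preserves the sum over a period. *)
Lemma sum_half_deg :
  \sum_(0 <= s < n) half_deg s = \sum_(0 <= s < n) \sum_(1 <= k < n) b s k.
Proof.
have hn := half_le.
have split_mid s : \sum_(1 <= k < n) b s k =
    \sum_(1 <= k < n - h) b s k + \sum_(n - h <= k < n) b s k.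
  by rewrite -big_cat_nat //=; lia.
under [RHS]eq_bigr do rewrite split_mid.
rewrite !big_split /= addnC; congr addn.
rewrite exchange_big_nat [RHS]exchange_big_nat /=.
rewrite big_add1 /= -[X in \sum_(X <= _ < n) _]add0n big_addn subKn; last lia.
rewrite [RHS]big_nat_rev; apply: eq_big_nat => k kh.
rewrite -[RHS](@sum_period_shift (fun s => nat_of_bool (b s _)) k.+1) => [|s].
  apply: eq_bigr => s _; rewrite arc_opp; last lia.
  by congr (nat_of_bool (b _ _)); lia.
by rewrite arc_period.
Qed.

Hypothesis window_dense : forall t, n ^ 2 < 50 * window_edges t.

Lemma half_gt0 : 0 < h.
Proof.
by move: (window_dense 0); rewrite /window_edges; case: h => //; rewrite big_geq.
Qed.

(* Otherwise the complementary window is independent. *)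
Lemma window_span s : P (s + h) - P s <= 2 * d - 1.
Proof.
have hn := half_le; rewrite leqNgt; apply/negP => span.
have: 0 < window_edges (s + h) by have := window_dense (s + h); case: window_edges.
rewrite /window_edges big_nat big1 // => i ih.
rewrite big_nat big1 // => k kh; apply/eqP; rewrite eqb0; apply/negP => /andP[bl _].
have: P (s + h + i + k) <= P (s + n) by apply: P_mono; lia.
have: P (s + h) <= P (s + h + i) by apply: P_mono; lia.
by rewrite P_period; lia.
Qed.

(** Take the least m with [t + m] closer than d to the last window vertex; from there on no edge
    starts inside the window. For i < m, the arcs of h - i to h steps from [t + i] leave the window,
    so they have length at least d, and at most 2d - 1 by [window_span]. All are edges: i + 1 of
    them enter the first sum of [half_deg] and at least i the second, and the numbers 2i + 1 sum to
    m^2. *)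
Lemma half_deg_tile t :
  exists m, 2 * window_edges t + m ^ 2 <= \sum_(0 <= i < m) half_deg (t + i).
Proof.
have hn := half_le; have h0 := half_gt0.
have ex : exists i, P (t + h - 1) < P (t + i) + d.
  by exists (h - 1); rewrite addnBA //; lia.
case: (ex_minnP ex) => m last_m m_min.
have mh : m <= h by apply: leq_trans (m_min (h - 1) _) _; rewrite ?addnBA //; lia.
exists m; rewrite /window_edges (@big_cat_nat _ _ _ m) //=.
have -> : \sum_(m <= i < h) \sum_(1 <= k < h - i) b (t + i) k = 0.
  rewrite big_nat big1 // => i mih; rewrite big_nat big1 // => k kh.
  apply/eqP; rewrite eqb0; apply/negP => /andP[bl _].
  have: P (t + i + k) <= P (t + h - 1) by apply: P_mono; lia.
  have: P (t + m) <= P (t + i) by apply: P_mono; lia.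
  by lia.
have sqE : m ^ 2 = \sum_(0 <= i < m) (2 * i + 1).
  elim: m {last_m m_min mh} => [|m IH]; first by rewrite big_geq.
  by rewrite big_nat_recr //= -IH; lia.
rewrite addn0 sqE big_distrr -big_split big_nat [leqRHS]big_nat /=.
apply: leq_sum => i im.
have full k : h - i <= k <= h -> b (t + i) k.
  move=> hk; rewrite /b.
  have: P (t + h - 1) >= P (t + i) + d.
    by rewrite leqNgt; apply/negP => /m_min; lia.
  have: P (t + h - 1) <= P (t + i + k) by apply: P_mono; lia.
  have: P (t + i + k) <= P (t + i + h) by apply: P_mono; lia.
  by have := window_span (t + i); lia.
have fullS j : h - i <= j <= h.+1 ->
    \sum_(1 <= k < j) b (t + i) k =
    \sum_(1 <= k < h - i) b (t + i) k + (j - (h - i)).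
  move=> hj; rewrite (@big_cat_nat _ _ _ (h - i)) //=; try lia.
  rewrite [X in _ + X](@eq_big_nat _ _ _ _ _ _ (fun=> 1)); last first.
    by move=> k hk; rewrite full //; lia.
  by rewrite sum_nat_const_nat muln1.
rewrite /half_deg (fullS h.+1); last lia.
have: \sum_(1 <= k < h) b (t + i) k <= \sum_(1 <= k < n - h) b (t + i) k.
  by rewrite [leqRHS](@big_cat_nat _ _ _ h) /= ?leq_addr //; lia.
rewrite (fullS h); last lia.
set X := \sum_(_ <= _ < _ - i) _; set Y := \sum_(_ <= _ < _) _.
by lia.
Qed.

(* If this fails, the prefix sums [F t] of 5 * half_deg - 2 * n attain a maximum,
   and the tile starting at a maximum increases [F] further. *)
Lemma circular_edges_gt :
  2 * n ^ 2 < 5 * \sum_(0 <= s < n) \sum_(1 <= k < n) b s k.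
Proof.
rewrite -sum_half_deg ltnNge; apply/negP => sum_le.
pose F t := (5 * (\sum_(0 <= s < t) half_deg s)%:Z - 2 * n%:Z * t%:Z)%R.
(* A full turn does not raise [F], so its maximum over one turn is global. *)
have F_period t : (F (t + n) <= F t)%R.
  rewrite /F big_nat_addn (@sum_period_shift half_deg t) => [|s]; last first.
    by rewrite /half_deg; congr addn; apply: eq_bigr => k _; rewrite arc_period.
  move: sum_le; set X := \sum_(_ <= _ < _) _; set Y := \sum_(_ <= _ < _) _.
  by rewrite !PoszD mulrDr -mulnn; lia.
have F_le t : (exists2 t0, (t0 < n)%N & (F t <= F t0)%R).
  elim/ltn_ind: t => t IH; have [tn|nt] := ltnP t n; first by exists t.
  have [|t0 t0n le0] := IH (t - n); first lia.
  by exists t0 => //; apply: le_trans le0; rewrite -{1}(subnK nt).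
case: (@arg_maxP _ _ _ (Ordinal n_gt0) xpredT (fun i : 'I_n => F i)) => // t _ tmax.
have [m tile] := half_deg_tile t.
have [t0 t0n] := F_le (t + m).
have := tmax (Ordinal t0n) isT; rewrite /= => le1 le2.
have := le_trans le2 le1.
rewrite /F big_nat_addn.
under [\sum_(0 <= i < m) _]eq_bigr do rewrite addnC.
have := window_dense t.
(* This is n^2/25 + m^2 >= (2n/5) m. *)
have : (0 <= (n%:Z - 5 * m%:Z) ^+ 2)%R by apply: sqr_ge0.
move: tile; set X := \sum_(0 <= i < m) _; set Y := \sum_(_ <= _ < _) _.
set w := window_edges t.
by rewrite -!mulnn expr2 !PoszD; lia.
Qed.

End CircularOrder.

(** * The blow-up of the Andrásfai graph *)

Lemma sum_nat_sym (g : nat -> nat -> nat) h :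
  (forall i j, g i j = g j i) -> (forall i, g i i = 0) ->
  \sum_(0 <= i < h) \sum_(0 <= j < h) g i j =
  2 * \sum_(0 <= i < h) \sum_(1 <= k < h - i) g i (i + k).
Proof.
move=> g_sym g_diag; elim: h => [|h IH]; first by rewrite !big_geq.
rewrite big_nat_recr //= [in RHS]big_nat_recr //= subSnn (@big_geq _ _ _ 1 1) // addn0.
under eq_bigr do rewrite big_nat_recr //=.
rewrite big_split /= IH big_nat_recr //= g_diag addn0.
under [X in _ + _ + X = _]eq_bigr do rewrite g_sym.
rewrite -addnA addnn -mul2n -mulnDr; congr (2 * _).
rewrite -big_split /= !big_nat; apply: eq_bigr => i ih.
by rewrite subSn ?big_nat_recr ?subnKC //=; lia.
Qed.

Section BlowUp.

Variables (T : finType) (x0 : T) (d : nat) (f : T -> 'I_(3 * d - 1)).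
Hypothesis d_gt0 : 0 < d.

Let n := #|T|.
Let h := n./2.
Let e : rel T := fun x y => andrasfai_rel (f x) (f y).
Let s := sort (fun x y => f x <= f y) (enum T).

Definition circ_vertex i := nth x0 s (i %% n).
(** Every completed turn adds 3d - 1, which makes the position monotone. *)
Definition circ_pos i := f (circ_vertex i) + (3 * d - 1) * (i %/ n).

Let v := circ_vertex.
Let P := circ_pos.

Let n_gt0 : 0 < n.
Proof. by apply/card_gt0P; exists x0. Qed.

Let size_s : size s = n.
Proof. by rewrite size_sort -cardE. Qed.

Lemma circ_vertex_period i : v (i + n) = v i.
Proof. by rewrite /v /circ_vertex modnDr. Qed.

Lemma circ_vertex_inj t i j : i < n -> j < n -> v (t + i) = v (t + j) -> i = j.
Proof.
move=> im jn /eqP; rewrite nth_uniq ?size_s ?ltn_mod ?sort_uniq ?enum_uniq //.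
by rewrite eqn_modDl !modn_small // => /eqP.
Qed.

Lemma circ_pos_period i : P (i + n) = P i + (3 * d - 1).
Proof.
by rewrite /P /circ_pos -/v circ_vertex_period divnDr // divnn n_gt0; lia.
Qed.

Lemma circ_pos_mono : {homo P : i j / i <= j}.
Proof.
move=> i j ij; rewrite /P /circ_pos.
have [qE|qlt] := eqVneq (i %/ n) (j %/ n).
  rewrite qE leq_add2r.
  apply: (@sorted_leq_nth _ (fun x y => f x <= f y)); rewrite ?inE ?size_s ?ltn_mod //.
  - by move=> y x z; apply: leq_trans.
  - by apply: sort_sorted => x y; apply: leq_total.
  - by move: ij; rewrite {1}(divn_eq i n) {1}(divn_eq j n) qE leq_add2l.
have : i %/ n < j %/ n by rewrite ltn_neqAle qlt leq_div2r.
move=> /(leq_mul (leqnn (3 * d - 1))); rewrite mulnSr => le_next.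
apply: leq_trans (leq_addl _ _); apply: leq_trans le_next.
by rewrite addnC leq_add2l ltnW.
Qed.

(** Within one turn the difference of positions is |f x - f y|, or 3d - 1 minus it if the arc passes
    the origin; [d, 2d - 1] is symmetric under this change. *)
Lemma circ_arc i k : 0 < k < n -> e (v i) (v (i + k)) = (d <= P (i + k) - P i <= 2 * d - 1).
Proof.
move=> kn; rewrite /e /andrasfai_rel.
have q_ge : i %/ n <= (i + k) %/ n by rewrite leq_div2r // leq_addr.
have q_le : (i + k) %/ n <= (i %/ n).+1.
  apply: (@leq_trans ((i + n) %/ n)); first by rewrite leq_div2r //; lia.
  by rewrite divnDr // divnn n_gt0 addn1.
have Pge : P i <= P (i + k) by apply: circ_pos_mono; rewrite leq_addr.
have : P (i + k) <= P (i + n) by apply: circ_pos_mono; lia.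
rewrite circ_pos_period; move: Pge; rewrite /P /circ_pos -/v.
have qE : (i + k) %/ n = i %/ n \/ (i + k) %/ n = (i %/ n).+1.
  by move: ((i + k) %/ n) (i %/ n) q_ge q_le => a c; lia.
case: qE => ->.
  by move=> le1 le2; rewrite distnEr; lia.
by rewrite mulnSr => le1 le2; rewrite distnEl; lia.
Qed.

Lemma sum_circ_vertex (F : T -> nat) i : \sum_(0 <= k < n) F (v (i + k)) = \sum_x F x.
Proof.
under eq_bigr do rewrite addnC.
rewrite (@sum_period_shift n n_gt0 (fun k => F (v k))) => [|k]; last by rewrite circ_vertex_period.
rewrite -big_enum /= [RHS](perm_big s) /=; last by rewrite perm_sym perm_sort.
rewrite [RHS](big_nth x0) size_s; apply: eq_big_nat => k kn.
by rewrite /v /circ_vertex modn_small.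
Qed.

Lemma blowup_sym : symmetric e.
Proof. by move=> x y; apply: andrasfai_sym. Qed.

Lemma blowup_irr : irreflexive e.
Proof. by move=> x; apply: andrasfai_irr. Qed.

(** Of three values, two consecutive gaps of at least d would make the outer gap at least 2d. *)
Lemma blowup_triangle_free x y z : e x y -> e y z -> ~~ e x z.
Proof. by rewrite /e /andrasfai_rel; lia. Qed.

Lemma blowup_not_half_dense :
  ~ (forall A : {set T}, #|A| = h -> n ^ 2 < 25 * \sum_(x in A) \sum_(y in A) e x y).
Proof.
move=> dense_e.
have := dense_edges_lt blowup_sym blowup_triangle_free dense_e n_gt0.
rewrite ltnNge => /negP[]; apply/ltnW.
have hn : h + h <= n by rewrite /h; lia.
have window_dense t : n ^ 2 < 50 * window_edges n d P t.
  pose w (i : 'I_h) := v (t + i).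
  have w_inj : injective w.
    by move=> i j /circ_vertex_inj E; apply/val_inj/E; have := ltn_ord i; have := ltn_ord j; lia.
  have := dense_e (w @: 'I_h); rewrite card_imset // card_ord => /(_ erefl).
  have sum_window (F : T -> nat) :
      \sum_(x in w @: 'I_h) F x = \sum_(0 <= i < h) F (v (t + i)).
    by rewrite big_imset ?big_mkord // => i j _ _; apply: w_inj.
  rewrite sum_window; under eq_bigr do rewrite sum_window.
  rewrite (@sum_nat_sym (fun i j => e (v (t + i)) (v (t + j)))) => [|i j|i]; last 2 first.
  - by rewrite blowup_sym.
  - by rewrite blowup_irr.
  rewrite mulnA; congr (_ < _ * _).
  rewrite /window_edges; apply: eq_big_nat => i ih; apply: eq_big_nat => k kh.
  by rewrite addnA circ_arc //; lia.
have := circular_edges_gt n_gt0 d_gt0 circ_pos_mono circ_pos_period window_dense.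
move/leq_trans; apply; rewrite leq_mul2l /=.
rewrite -(sum_circ_vertex _ 0); apply: leq_sum => i _; rewrite add0n.
rewrite -(sum_circ_vertex _ i) [leqRHS]big_ltn // addn0 blowup_irr add0n.
rewrite leq_eqVlt; apply/orP; left; apply/eqP; apply: eq_big_nat => k kn.
by rewrite circ_arc.
Qed.

End BlowUp.

(** * Transfer of density from G to the blow-up *)

(** Each edge comes from an adjacent pair increasing in [enum_rank], and the double sum sees such a
    pair in both orders. *)
Lemma induced_edges_le (G : sgraph) (A : {set G}) :
  2 * #|induced_edges A| <= \sum_(x in A) \sum_(y in A) adj x y.
Proof.
pose lt (x y : G) := enum_rank x < enum_rank y.
pose L := [set p : G * G | (p.1 \in A) && (p.2 \in A) && (adj p.1 p.2 && lt p.1 p.2)].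
have cardL : #|L| = \sum_(x in A) \sum_(y in A) (adj x y && lt x y).
  rewrite pair_big /= -sum1_card -big_mkcondr.
  by apply: eq_bigl => p; rewrite inE.
have edgeL : induced_edges A \subset [set [set p.1; p.2] | p in L].
  apply/subsetP => E; rewrite inE => /andP[/imsetP[[x y]]]; rewrite inE /= => xy -> /subsetP sub.
  have xA : x \in A by apply: sub; rewrite !inE eqxx.
  have yA : y \in A by apply: sub; rewrite !inE eqxx orbT.
  have [xy_lt|yx_lt|/val_inj/enum_rank_inj xyE] := ltngtP (enum_rank x) (enum_rank y).
  - by apply/imsetP; exists (x, y); rewrite // inE xA yA xy.
  - by apply/imsetP; exists (y, x); rewrite 1?setUC // inE xA yA adj_sym xy.
  - by rewrite xyE adj_irr in xy.
have leL : #|induced_edges A| <= #|L|.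
  by apply: leq_trans (subset_leq_card edgeL) (leq_imset_card _ _).
apply: leq_trans (_ : 2 * #|L| <= _); first by rewrite leq_mul2l leL.
rewrite mul2n -addnn {1}cardL cardL [X in X + _]exchange_big -big_split /=.
apply: leq_sum => x _; rewrite -big_split /=; apply: leq_sum => y _.
rewrite /lt adj_sym; case: (adj x y) => //=.
by case: ltngtP.
Qed.

Lemma floor_half (m : nat) : (Num.floor (1 / 2 * m%:R : rat) = (m./2)%:Z)%R.
Proof.
apply: floor_def; rewrite -{2 3}(odd_double_half m) -muln2.
by rewrite natrD natrM; case: (odd m) => /=; lra.
Qed.

Theorem theorem1p2 (G : sgraph) (d : nat) (hd : 1 <= d)
  (hG : homomorphic G (andrasfai d)) :
  ~ dense (1 / 2 : rat)%R (1 / 50 : rat)%R G.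
Proof.
case: hG => f f_hom G_dense.
have half_dense (A : {set G}) : #|A| = #|G|./2 ->
    #|G| ^ 2 < 25 * \sum_(x in A) \sum_(y in A) andrasfai_rel (f x) (f y).
  move=> cardA; have := G_dense A; rewrite floor_half cardA => /(_ erefl).
  rewrite mul1r mulrC ltr_pdivrMr // -natrX -natrM ltr_nat => /leq_trans; apply.
  rewrite (_ : 50 = 2 * 25) // mulnA [leqRHS]mulnC leq_mul2r /= mulnC.
  apply: leq_trans (induced_edges_le A) _.
  apply: leq_sum => x _; apply: leq_sum => y _.
  (* By [f_hom], G is a subgraph of the blow-up. *)
  by case xy: (adj x y) => //; have /= -> := f_hom _ _ xy.
have [G0|/card_gt0P[x0 _]] := posnP #|G|.
  have := half_dense set0; rewrite G0 cards0 => /(_ erefl).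
  by rewrite big_set0.
exact: (blowup_not_half_dense x0 hd half_dense).
Qed.
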